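(* Let $a$ be a fixed odd natural number. For each positive integer $n$, let $n$ mobile sensors be placed independently and uniformly at random in $[0,1]$, let $X_1\le X_2\le\dots\le X_n$ be their positions in increasing order (so $X_i$ is the $i$-th order statistic), and let $t_i=\frac{i}{n}-\frac{1}{2n}$ for $i=1,\dots,n$. Then the expected sum of displacements to the power $a$ when the $i$-th sensor moves from $X_i$ to the anchor location $t_i$, for $i=1,\dots,n$, satisfies $$\sum_{i=1}^{n}\mathbf{E}\left[|X_i-t_i|^a\right]\in\Theta\left(\frac{1}{n^{\frac{a}{2}-1}}\right)\qquad (n\to\infty).$$
   Context: The implied constants in $\Theta(\cdot)$ may depend on $a$ but not on $n$. *)

(* Defs.v *)
From HB Require Import structures.
From mathcomp Require Import all_boot all_order all_algebra.
From mathcomp Require Import all_classical all_reals all_analysis.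

Set Implicit Arguments.
Unset Strict Implicit.
Unset Printing Implicit Defensive.

Import Order.TTheory GRing.Theory Num.Theory.
Import numFieldNormedType.Exports.

Local Open Scope classical_set_scope.
Local Open Scope ring_scope.

(* Product rule over every subfamily J of events generated by the X i. *)
Definition mutually_independent (d : measure_display) (T : measurableType d)
    (R : realType) (P : probability T R) (I : finType)
    (X : I -> {RV P >-> R}) : Prop :=
  forall (J : {set I}) (B : I -> set R), (forall i, measurable (B i)) ->
    P (\bigcap_(i in [set i | i \in J]) X i @^-1` B i)
    = (\prod_(i in J) P (X i @^-1` B i))%E.

(* The equality of laws is required on Borel sets only: the values that
   [distribution] and [uniform_prob] take on other sets are irrelevant. *)
Definition uniform01 (d : measure_display) (T : measurableType d)
    (R : realType) (P : probability T R) (X : {RV P >-> R}) : Prop :=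
  forall B : set R, measurable B ->
    distribution P X B = uniform_prob (@ltr01 R) B.

(* Ordinals start at 0, so [order_stat U i] is the (i+1)-th smallest value and
   [anchor R i] is (i+1)/n - 1/(2n). *)
Definition order_stat (R : realType) (T : Type) (n : nat)
    (U : 'I_n -> T -> R) (i : 'I_n) (w : T) : R :=
  nth 0 (sort <=%R [seq U j w | j <- enum 'I_n]) i.

Definition anchor (R : realType) (n : nat) (i : 'I_n) : R :=
  i.+1%:R / n%:R - (2 * n%:R)^-1.

Definition expected_displacement (d : measure_display) (T : measurableType d)
    (R : realType) (P : probability T R) (n : nat) (U : 'I_n -> {RV P >-> R})
    (a : nat) : \bar R :=
  (\sum_(i < n)
     'E_P[fun w => (`|order_stat (fun j => U j) i w - anchor R i| ^+ a)%R])%E.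

(* Main.v *)
Require Import Defs.
From HB Require Import structures.
From mathcomp Require Import all_boot all_order all_algebra.
From mathcomp Require Import all_classical all_reals all_analysis.
From mathcomp Require Import measurable_realfun zify ring lra.
Import Order.TTheory GRing.Theory Num.Theory.
Import numFieldNormedType.Exports.
Local Open Scope classical_set_scope.
Local Open Scope ring_scope.

Set Implicit Arguments.
Unset Strict Implicit.
Unset Printing Implicit Defensive.

(* Let N_u be the number of sensors in [0, u]. It has the binomial law with
   parameters n and u, and X_i <= u iff N_u >= i, so deviations of X_i from t_i
   of order x / sqrt n are deviations of N_u from n u of order x sqrt n.
   Upper bound: a Chernoff estimate gives P(|X_i - t_i| > x / sqrt n) <=
   2 exp (2 - x), hence E|X_i - t_i|^a = O(n^(-a/2)) uniformly in i.
   Lower bound: for n/4 <= k < n/2, N_(k/n) differs from k by at least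
   r ~ sqrt n / 8 with probability bounded below; then X_(k+r) <= k/n or
   X_(k-r+1) > k/n, which displaces one of these two sensors by at least
   (r - 1/2)/n. Summing over k counts each sensor at most twice, so order n of
   the summands are of order n^(-a/2). *)

(** * Means under the binomial law *)

Definition binomial_mean (R : realType) (n : nat) (p : R) (f : nat -> R) : R :=
  \sum_(m < n.+1) 'C(n, m)%:R * p ^+ m * (1 - p) ^+ (n - m) * f m.

(** Conditioning on one trial: a failure keeps the count, a success shifts it by one. For the
    explicit sums this is Pascal's rule. *)
Lemma binomial_meanS (R : realType) (n : nat) (p : R) (f : nat -> R) :
  binomial_mean n.+1 p f =
  (1 - p) * binomial_mean n p f + p * binomial_mean n p (f \o succn).
Proof.
rewrite /binomial_mean big_ord_recl /= !mulr_sumr.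
rewrite [X in _ = X + _]big_ord_recl /= -addrA; congr (_ + _).
  by rewrite !bin0 !expr0 !subn0 exprS; ring.
(* The reindexed sum may run one term further, since that term carries ['C(n, n.+1)], which is 0. *)
have -> : \sum_(i < n) (1 - p) * ('C(n, lift ord0 i)%:R *
            p ^+ lift ord0 i * (1 - p) ^+ (n - lift ord0 i) * f (lift ord0 i))
        = \sum_(i < n.+1) (1 - p) ^+ (n.+1 - i.+1) *
            ('C(n, i.+1)%:R * p ^+ i.+1 * f i.+1).
  rewrite big_ord_recr /= bin_small // !mul0r mulr0 addr0.
  apply: eq_bigr => i _; rewrite /= /bump /= add1n subSS.
  by rewrite -(subnSK (ltn_ord i)) !exprS; ring.
rewrite -big_split /=; apply: eq_bigr => i _.
rewrite /bump /= !add1n binS natrD !subSS !exprS; ring.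
Qed.

Lemma binomial_mean0 (R : realType) (p : R) f : binomial_mean 0 p f = f 0%N.
Proof. by rewrite /binomial_mean big_ord1 bin0 !expr0 !mul1r. Qed.

Lemma binomial_mean_exp (R : realType) (n : nat) (p b x : R) :
  binomial_mean n p (fun m => b * x ^+ m) = b * (1 - p + p * x) ^+ n.
Proof.
elim: n b => [|n IH] b; first by rewrite binomial_mean0.
rewrite binomial_meanS IH.
have -> : (fun m => b * x ^+ m) \o succn = (fun m => b * x * x ^+ m).
  by apply/funext => m /=; rewrite exprS mulrA.
by rewrite IH exprS; ring.
Qed.

(** Variance plus squared bias. The centre [c] is arbitrary because a success moves it to [c - 1] in
    the induction. *)
Lemma binomial_mean_sqr (R : realType) (n : nat) (p c : R) :
  binomial_mean n p (fun m => (m%:R - c) ^+ 2) =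
  n%:R * p * (1 - p) + (n%:R * p - c) ^+ 2.
Proof.
elim: n c => [|n IH] c; first by rewrite binomial_mean0; ring.
rewrite binomial_meanS IH.
have -> : (fun m => (m%:R - c) ^+ 2) \o succn = (fun m => (m%:R - (c - 1)) ^+ 2).
  by apply/funext => m /=; rewrite -natr1; ring.
by rewrite IH -natr1; ring.
Qed.

Lemma le_binomial_mean (R : realType) (n : nat) (p : R) (f g : nat -> R) :
  0 <= p <= 1 -> (forall m, (m <= n)%N -> f m <= g m) ->
  binomial_mean n p f <= binomial_mean n p g.
Proof.
move=> /andP[p0 p1] fg; apply: ler_sum => i _.
apply: ler_wpM2l; last by apply: fg; rewrite -ltnS.
by rewrite !mulr_ge0 // exprn_ge0 // subr_ge0.
Qed.

Lemma binomial_meanD (R : realType) (n : nat) (p : R) (f g : nat -> R) :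
  binomial_mean n p (fun m => f m + g m) =
  binomial_mean n p f + binomial_mean n p g.
Proof. by rewrite -big_split; apply: eq_bigr => i _; rewrite mulrDr. Qed.

Lemma binomial_meanZ (R : realType) (n : nat) (p b : R) (f : nat -> R) :
  binomial_mean n p (fun m => b * f m) = b * binomial_mean n p f.
Proof. by rewrite mulr_sumr; apply: eq_bigr => i _; rewrite mulrCA. Qed.

Lemma binomial_mean_cst (R : realType) (n : nat) (p b : R) :
  binomial_mean n p (fun=> b) = b.
Proof.
have -> : (fun=> b) = (fun m => b * 1 ^+ m) :> (nat -> R).
  by apply/funext => m; rewrite expr1n mulr1.
by rewrite binomial_mean_exp mulr1 subrK expr1n mulr1.
Qed.

(** * Exponential moments and the Chernoff bound *)

(** Squaring exp(-x/2) >= 1 - x/2 gives exp(-x) >= (1 - x/2)^2, and on [-1, 1] this square times the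
    quadratic is at least 1. *)
Lemma expR_le_quadratic (R : realType) (x : R) :
  -1 <= x <= 1 -> expR x <= 1 + x + 2 * x ^+ 2.
Proof.
move=> /andP[xN1 x1].
have h : (1 - x / 2) ^+ 2 <= expR (- x).
  have -> : - x = - x / 2 * 2%:R by field.
  rewrite expRM_natr; apply: lerXn2r; rewrite ?nnegrE ?expR_ge0 //; first by lra.
  by have := expR_ge1Dx (- x / 2); lra.
have e0 := expR_gt0 x.
have e1 := expRxMexpNx_1 x.
have h2 : 1 <= (1 - x / 2) ^+ 2 * (1 + x + 2 * x ^+ 2).
  have : 0 <= x ^+ 2 * ((1 - x) * (5 - 2 * x)).
    by apply: mulr_ge0; [exact: sqr_ge0 | apply: mulr_ge0; lra].
  by lra.
have h3 : 0 <= 1 + x + 2 * x ^+ 2 by nra.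
have h4 : 1 <= expR (- x) * (1 + x + 2 * x ^+ 2).
  by apply: (le_trans h2); apply: ler_wpM2r.
have := ler_wpM2l (ltW e0) h4.
by rewrite mulr1 mulrA e1 mul1r.
Qed.

(** Here [l] is 1 / sqrt n or its negative, so both tails are served. The mean is an [n]-th power
    whose base is at most exp(p l + 2 l^2); centring cancels the linear part and leaves exp(2 n
    l^2). *)
Lemma binomial_mean_expR (R : realType) (n : nat) (p l : R) :
  0 <= p <= 1 -> l ^+ 2 * n%:R = 1 ->
  binomial_mean n p (fun m => expR (l * (m%:R - n%:R * p))) <= expR 2.
Proof.
move=> p01 ln.
have n0 : (0 < n)%N by case: n ln => // ; rewrite mulr0 => /eqP; rewrite eq_sym oner_eq0.
have l1 : -1 <= l <= 1.
  rewrite -ler_norml -(@ler_pXn2r _ 2) // ?nnegrE // expr1n real_normK ?num_real //.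
  have : (1 : R) <= n%:R by rewrite ler1n.
  have := sqr_ge0 l; nra.
have -> : (fun m : nat => expR (l * (m%:R - n%:R * p))) =
          (fun m => expR (- l * (n%:R * p)) * expR l ^+ m).
  by apply/funext => m; rewrite -expRM_natr -expRD; congr expR; ring.
rewrite binomial_mean_exp.
have /andP[p0 p1] := p01.
have h : 1 - p + p * expR l <= expR (p * l + 2 * l ^+ 2).
  have := expR_le_quadratic l1; have := expR_ge1Dx (p * l + 2 * l ^+ 2).
  have := sqr_ge0 l; nra.
have h0 : 0 <= 1 - p + p * expR l by have := expR_ge0 l; nra.
apply: (@le_trans _ _ (expR (- l * (n%:R * p)) * expR (p * l + 2 * l ^+ 2) ^+ n)).
  by apply: ler_wpM2l; [exact: expR_ge0 | apply: lerXn2r; rewrite ?nnegrE // expR_ge0].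
rewrite -expRM_natr -expRD ler_expR.
by rewrite (_ : 2 = 2 * (l ^+ 2 * n%:R)) ?ln ?mulr1 //; lra.
Qed.

(** Markov's inequality applied to the exponential moment. *)
Lemma binomial_tail (R : realType) (n : nat) (p l x : R) :
  0 <= p <= 1 -> l ^+ 2 * n%:R = 1 ->
  binomial_mean n p (fun m => (x <= l * (m%:R - n%:R * p))%R%:R) <= expR (2 - x).
Proof.
move=> p01 ln.
apply: (@le_trans _ _ (binomial_mean n p
  (fun m => expR (- x) * expR (l * (m%:R - n%:R * p))))).
  apply: le_binomial_mean => // m _; rewrite -expRD.
  case: (leP x) => [h|_]; last by rewrite mulr0n expR_ge0.
  rewrite [X in X <= _](_ : _ = expR 0) ?ler_expR ?expR0 //.
  by rewrite addrC subr_ge0.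
rewrite binomial_meanZ addrC expRD.
by apply: ler_wpM2l; [exact: expR_ge0 | exact: binomial_mean_expR].
Qed.

(** * Anticoncentration of the binomial law *)

(** The degree 4 term of the exponential series at |y|; it lets exponential moments control the
    fourth moment. *)
Lemma expR_ge_quartic (R : realType) (y : R) :
  y ^+ 4 <= 24 * (expR y + expR (- y)).
Proof.
have h (z : R) : 0 <= z -> z ^+ 4 <= 24 * expR z.
  move=> z0; have := @expR_ge1Dxn R z 3 z0.
  rewrite (_ : 4`!%:R = 24 :> R); [lra | by []].
have [y0|y0] := leP 0 y.
  by have := h _ y0; have := expR_ge0 (- y); lra.
have /h : 0 <= - y by lra.
have := expR_ge0 y; rewrite (_ : (- y) ^+ 4 = y ^+ 4); first by lra.
by ring.
Qed.

(* Paley-Zygmund: the second moment is of order 1 and the fourth one bounded. *)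
Lemma binomial_anticoncentration (R : realType) (n : nat) (p l : R) :
  0 <= p <= 1 -> 1 / 16 <= p * (1 - p) -> l ^+ 2 * n%:R = 1 ->
  (32 * (48 * (64 * expR 2)))^-1 <=
  binomial_mean n p (fun m => (8^-1 <= `|l * (m%:R - n%:R * p)|)%R%:R).
Proof.
move=> p01 pp ln.
pose y (m : nat) := l * (m%:R - n%:R * p).
(* With this [M] the fourth moment term [24 / M * (2 * expR 2)] is [1 / 64]. *)
pose M : R := 48 * (64 * expR 2).
have M0 : 0 < M by rewrite !mulr_gt0 ?expR_gt0.
have Ey2 : binomial_mean n p (fun m => y m ^+ 2) = p * (1 - p).
  rewrite (_ : (fun m => y m ^+ 2) = (fun m => l ^+ 2 * (m%:R - n%:R * p) ^+ 2)).
    by rewrite binomial_meanZ binomial_mean_sqr subrr expr0n addr0 -mulrA mulrA ln mul1r.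
  by apply/funext => m; rewrite exprMn.
have El : binomial_mean n p (fun m => expR (y m)) <= expR 2.
  exact: binomial_mean_expR.
have ENl : binomial_mean n p (fun m => expR (- y m)) <= expR 2.
  under eq_fun do rewrite /y -mulNr.
  by apply: binomial_mean_expR => //; rewrite sqrrN.
set q := binomial_mean _ _ _.
(* Averages the pointwise bound y^2 <= 1/64 + M 1(|y| >= 1/8) + y^4 / M. Below 1/8 the first term
   suffices; otherwise either y^2 <= M or y^2 <= y^4 / M. *)
have key : p * (1 - p) <= 64^-1 + (M * q + 24 / M * (expR 2 + expR 2)).
  rewrite -Ey2 -[64^-1](binomial_mean_cst n p) -binomial_meanZ.
  apply: (@le_trans _ _ (binomial_mean n p (fun=> 64^-1) +
     (binomial_mean n p (fun m => M * (8^-1 <= `|y m|)%R%:R) +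
      24 / M * (binomial_mean n p (fun m => expR (y m)) +
                binomial_mean n p (fun m => expR (- y m)))))); last first.
    rewrite !lerD2l; apply: ler_wpM2l; last exact: lerD.
    by rewrite divr_ge0 // ltW.
  rewrite -!binomial_meanD -binomial_meanZ -!binomial_meanD.
  apply: le_binomial_mean => // m _.
  have q4 := expR_ge_quartic (y m).
  have h4 : y m ^+ 4 / M <= 24 / M * (expR (y m) + expR (- y m)).
    by rewrite (mulrAC 24) ler_pM2r ?invr_gt0.
  have y2 := sqr_ge0 (y m).
  have y4 : 0 <= y m ^+ 4 / M.
    by rewrite (exprM _ 2 2) divr_ge0 ?sqr_ge0 ?(ltW M0).
  case: (leP 8^-1) => [h|h].
    rewrite mulr1n mulr1.
    have : y m ^+ 2 <= M + y m ^+ 4 / M.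
      have [hM|hM] := leP (y m ^+ 2) M; first by lra.
      suff : y m ^+ 2 <= y m ^+ 4 / M by lra.
      by rewrite ler_pdivlMr // (exprM _ 2 2) expr2 ler_wpM2l // ltW.
    lra.
  rewrite mulr0n mulr0.
  have : y m ^+ 2 <= 64^-1.
    rewrite -real_normK ?num_real // (_ : 64^-1 = 8^-1 ^+ 2); last by field.
    by rewrite lerXn2r ?nnegrE // ltW.
  lra.
have e0 := expR_gt0 (2 : R).
have e1 : 24 / M * (expR 2 + expR 2) = 64^-1.
  by rewrite /M; field; rewrite gt_eqF.
(* The variance is at least 1/16, and 1/16 - 1/64 - 1/64 = 1/32. *)
have h : 32^-1 <= M * q by lra.
by rewrite -/M invfM -(mulrC M^-1) ler_pdivrMl.
Qed.

(** * Order statistics and counts *)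

(** Induction on the list: if the head exceeds [u], so does everything after it, and both sides are
    false. *)
Lemma nth_sorted_le d (T : orderType d) (x0 u : T) (s : seq T) (i : nat) :
  sorted <=%O s -> (i < size s)%N ->
  (nth x0 s i <= u)%O = (i < count (fun x => (x <= u)%O) s)%N.
Proof.
elim: s i => [|x s IH] [|i] //= xs.
  case: (leP x u) => // ux; rewrite add0n; symmetry; apply/negbTE.
  rewrite -leqNgt leqn0; apply/eqP/eqP; rewrite -leqn0 leqNgt -has_count.
  apply/hasPn => y ys; rewrite -ltNge (lt_le_trans ux) //.
  exact: (allP (order_path_min le_trans xs)).
rewrite ltnS => /[dup] si /IH -> //; last exact: path_sorted xs.
case: (leP x u) => // ux; rewrite add0n.
suff -> : count (fun x => (x <= u)%O) s = 0%N by [].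
apply/eqP; rewrite -leqn0 leqNgt -has_count.
apply/hasPn => y ys; rewrite -ltNge (lt_le_trans ux) //.
exact: (allP (order_path_min le_trans xs)).
Qed.

Definition count_le (R : realType) (T : Type) (n : nat) (U : 'I_n -> T -> R)
  (u : R) (w : T) : nat := #|[pred j | U j w <= u]|.

Lemma order_stat_le (R : realType) (T : Type) (n : nat) (U : 'I_n -> T -> R)
    (i : 'I_n) (u : R) (w : T) :
  (order_stat U i w <= u) = (i < count_le U u w)%N.
Proof.
rewrite /order_stat nth_sorted_le ?size_sort ?size_map ?size_enum_ord //.
  rewrite (permP (permEl (perm_sort _ _))) count_map -size_filter.
  by rewrite /count_le cardE [in RHS]/enum_mem -enumT.
by rewrite -enumT size_enum_ord.
Qed.

(** * The binomial law of the count *)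

Lemma uniform01_le d (T : measurableType d) (R : realType)
    (P : probability T R) (X : {RV P >-> R}) (u : R) :
  uniform01 X -> 0 <= u <= 1 -> P (X @^-1` `]-oo, u]%classic) = u%:E.
Proof.
move=> unifX /andP[u0 u1].
have /unifX : measurable (`]-oo, u]%classic : set R) by exact: measurable_itv.
rewrite /distribution /pushforward => ->.
rewrite /uniform_prob integral_uniform_pdf.
have -> : `]-oo, u]%classic `&` `[0, 1]%classic = `[0, u]%classic :> set R.
  apply/seteqP; split => x /=; rewrite !in_itv /=.
    by case=> xu /andP[-> _].
  by move=> /andP[-> xu]; rewrite xu (le_trans xu).
rewrite (eq_integral (fun=> 1%:E)); last first.
  move=> x; rewrite inE /= in_itv /= => /andP[x0 xu].
  by rewrite /uniform_pdf x0 (le_trans xu u1) subr0 invr1.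
rewrite integral_cst //= lebesgue_measure_itv /= mul1e lte_fin.
by case: ltP => [_|u0']; rewrite ?sube0 //; congr (_%:E); apply/le_anti; rewrite u0.
Qed.

Section count_distribution.
Context d (T : measurableType d) (R : realType) (P : probability T R) (n : nat)
  (U : 'I_n -> {RV P >-> R}).

Let ray (u : R) (J : {set 'I_n}) (j : 'I_n) : set R :=
  if j \in J then `]-oo, u]%classic else `]u, +oo[%classic.

(** Prescribes exactly which sensors lie at or below [u]. Intersecting over the full index set
    matches the shape required by [mutually_independent]. *)
Let cell (u : R) (J : {set 'I_n}) : set T :=
  \bigcap_(j in [set j | j \in [set: 'I_n]%SET]) U j @^-1` ray u J j.

Let measurable_ray u J j : measurable (ray u J j).
Proof. by rewrite /ray; case: ifP => _; exact: measurable_itv. Qed.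

Let measurable_cell u J : measurable (cell u J).
Proof.
apply: fin_bigcap_measurable => // j _.
by rewrite -[X in measurable X]setTI; exact: measurable_funPT.
Qed.

Let cellE u J w : cell u J w <-> J = [set j | U j w <= u]%SET.
Proof.
split=> [h|-> j _]; last first.
  rewrite /ray /= inE; case: leP => h; rewrite /= in_itv /= ?h //.
apply/setP => j; rewrite inE.
have := h j (finset.in_setT j); rewrite /ray /=.
by case: ifP => _ /=; rewrite in_itv /= ?andbT // => /lt_geF ->.
Qed.

Let count_preimage u (A : pred nat) :
  [set w | A (count_le (fun j => U j) u w)] =
  \bigcup_(J in [set` [pred J : {set 'I_n} | A #|J|]]) cell u J.
Proof.
apply/seteqP; split => w /=.
  move=> Aw; exists [set j | U j w <= u]%SET => /=; last exact/cellE.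
  by rewrite inE cardsE.
by case=> J /= AJ /cellE JE; move: AJ; rewrite JE inE cardsE.
Qed.

Lemma measurable_count_le u (A : pred nat) :
  measurable [set w | A (count_le (fun j => U j) u w)].
Proof.
rewrite count_preimage; apply: fin_bigcup_measurable => //.
Qed.

(** The event is a finite disjoint union of cells. Independence gives a cell the probability u^|J|
    (1 - u)^(n - |J|), and ['C(n, m)] cells share each size [m]. *)
Lemma count_le_binomial (U_indep : mutually_independent U)
    (U_unif : forall j, uniform01 (U j)) u (A : pred nat) :
  0 <= u <= 1 ->
  P [set w | A (count_le (fun j => U j) u w)] =
  (binomial_mean n u (fun m => (A m)%:R))%:E.
Proof.
move=> u01; rewrite count_preimage measure_fin_bigcup //; last first.
  by move=> J K _ _ [w [/cellE -> /cellE ->]].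
rewrite -(bigfs _ (r := index_enum _)) ?index_enum_uniq //; last first.
  by move=> J _; rewrite mem_index_enum.
have mU j : measurable (U j @^-1` `]-oo, u]%classic).
  by rewrite -[X in measurable X]setTI; exact: measurable_funPT.
have Pcell J : P (cell u J) = (u ^+ #|J| * (1 - u) ^+ (n - #|J|))%:E.
  rewrite (U_indep [set: 'I_n]%SET (ray u J)); last exact: measurable_ray.
  under eq_bigr => j _.
    rewrite (_ : P _ = (if j \in J then u else 1 - u)%:E); last first.
      rewrite /ray; case: ifP => _; first exact: uniform01_le.
      rewrite -setCitvl preimage_setC probability_setC ?uniform01_le //.
      exact: mU.
    over.
  rewrite prodEFin; congr (_%:E).
  rewrite (bigID (mem J)) /=.
  rewrite (eq_bigr (fun=> u)); last by move=> j /andP[_ ->].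
  rewrite [X in _ * X](eq_bigr (fun=> 1 - u)); last by move=> j /andP[_ /negbTE ->].
  rewrite !prodr_const; congr (_ ^+ _ * _ ^+ _).
    by apply: eq_card => j; rewrite unfold_in finset.in_setT.
  rewrite -[X in (X - _)%N]card_ord -(cardsC J) addKn.
  by apply: eq_card => j; rewrite unfold_in finset.in_setT finset.in_setC.
rewrite (eq_bigr _ (fun J _ => Pcell J)) sumEFin; congr (_%:E).
rewrite /binomial_mean.
(* Groups the cells by cardinality; [inord] is faithful since a set of sensors has at most [n]
   elements. *)
rewrite (partition_big (fun J : {set 'I_n} => inord #|J| : 'I_n.+1) predT) //=.
apply: eq_bigr => m _.
rewrite (eq_bigl (fun J : {set 'I_n} => A m && (J \in [set J : {set 'I_n} | #|J| == m]%SET))); last first.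
  move=> J; rewrite inE -val_eqE /= inordK; last by rewrite ltnS -[n in (_ <= n)%N]card_ord max_card.
  by case: eqP => [->|]; rewrite ?andbF // andbT.
case: (A m) => /=; last by rewrite big_pred0_eq mulr0.
rewrite (eq_bigr (fun=> u ^+ m * (1 - u) ^+ (n - m))); last first.
  by move=> J; rewrite inE => /eqP ->.
by rewrite sumr_const card_draws card_ord mulr1 -mulrA mulr_natl.
Qed.

End count_distribution.

(** * Tails of the order statistics *)

Lemma binomial_mean_p0 (R : realType) (n : nat) (f : nat -> R) :
  binomial_mean n 0 f = f 0%N.
Proof.
rewrite /binomial_mean big_ord_recl big1 => [|i _].
  by rewrite bin0 expr0 subr0 expr1n !mul1r addr0.
by rewrite /= /bump /= add1n expr0n mulr0 !mul0r.
Qed.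

Lemma binomial_mean_p1 (R : realType) (n : nat) (f : nat -> R) :
  binomial_mean n 1 f = f n.
Proof.
rewrite /binomial_mean big_ord_recr big1 => [|i _] /=.
  by rewrite binn expr1n subnn expr0 !mul1r add0r.
by rewrite subrr expr0n subn_eq0 leqNgt ltn_ord mulr0 mul0r.
Qed.

Lemma order_stat_gt (R : realType) (T : Type) (n : nat) (U : 'I_n -> T -> R)
    (i : 'I_n) (u : R) (w : T) :
  (u < order_stat U i w) = (count_le U u w <= i)%N.
Proof. by rewrite ltNge order_stat_le -leqNgt. Qed.

Section order_statistics.
Context d (T : measurableType d) (R : realType) (P : probability T R) (n : nat)
  (U : 'I_n -> {RV P >-> R}).
Hypotheses (U_indep : mutually_independent U)
  (U_unif : forall j, uniform01 (U j)).

Let X (i : 'I_n) : T -> R := order_stat (fun j => U j) i.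

Lemma measurable_order_stat_le i (u : R) : measurable [set w | X i w <= u].
Proof.
rewrite (_ : [set _ | _] =
    [set w | (fun m => (i < m)%N) (count_le (fun j => U j) u w)]).
  exact: (measurable_count_le U u (fun m => (i < m)%N)).
by apply/seteqP; split => w /=; rewrite /X order_stat_le.
Qed.

Lemma measurable_order_stat_gt i (u : R) : measurable [set w | u < X i w].
Proof.
rewrite (_ : [set _ | _] =
    [set w | (fun m => (m <= i)%N) (count_le (fun j => U j) u w)]).
  exact: (measurable_count_le U u (fun m => (m <= i)%N)).
by apply/seteqP; split => w /=; rewrite /X order_stat_gt.
Qed.

Lemma measurable_order_stat i : measurable_fun setT (X i).
Proof.
apply: (measurability _ (RGenOInfty.measurableE R)) => //.
move=> _ [_ [u ->] <-]; rewrite setTI.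
rewrite (_ : _ @^-1` _ = [set w | u < X i w]).
  exact: measurable_order_stat_gt.
by apply/seteqP; split => w /=; rewrite in_itv /= andbT.
Qed.

Lemma measurable_displacement i : measurable_fun setT (fun w => `|X i w - anchor R i|).
Proof.
apply: measurableT_comp => //; apply: measurable_funB => //.
exact: measurable_order_stat.
Qed.

Lemma prob_order_stat_le i (u : R) : 0 <= u <= 1 ->
  P [set w | X i w <= u] = (binomial_mean n u (fun m => (i < m)%N%:R))%:E.
Proof.
move=> u01; rewrite -(count_le_binomial U_indep U_unif (fun m => (i < m)%N) u01).
by congr (P _); apply/seteqP; split => w /=; rewrite /X order_stat_le.
Qed.

Lemma prob_order_stat_gt i (u : R) : 0 <= u <= 1 ->
  P [set w | u < X i w] = (binomial_mean n u (fun m => (m <= i)%N%:R))%:E.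
Proof.
move=> u01; rewrite -(count_le_binomial U_indep U_unif (fun m => (m <= i)%N) u01).
by congr (P _); apply/seteqP; split => w /=; rewrite /X order_stat_gt.
Qed.

(** With [order_stat_gt1], this confines the sensors almost surely to ]0, 1], where displacements
    are at most 1. *)
Lemma order_stat_le0 i : P [set w | X i w <= 0] = 0%E.
Proof. by rewrite prob_order_stat_le ?lexx ?ler01 // binomial_mean_p0. Qed.

Lemma order_stat_gt1 i : P [set w | 1 < X i w] = 0%E.
Proof.
by rewrite prob_order_stat_gt ?lexx ?ler01 // binomial_mean_p1 leqNgt ltn_ord.
Qed.

Lemma anchorE (i : 'I_n) : n%:R * anchor R i = i%:R + 2^-1.
Proof.
have n0 : (n%:R : R) != 0 by rewrite pnatr_eq0 -lt0n (leq_ltn_trans _ (ltn_ord i)).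
by rewrite /anchor -natr1; field.
Qed.

Lemma anchor_itv (i : 'I_n) : 0 <= anchor R i <= 1.
Proof.
have n0 : (0 : R) < n%:R by rewrite ltr0n (leq_ltn_trans _ (ltn_ord i)).
have i0 : (0 : R) <= i%:R by [].
have : (i%:R + 1 : R) <= n%:R by rewrite natr1 ler_nat.
have := anchorE i; nra.
Qed.

Section tails.
Variables (l : R).
Hypotheses (l0 : 0 < l) (ln : l ^+ 2 * n%:R = 1).

(** At u = t_i + x l the event says that the count is at most [i], while its mean is i + 1/2 + n x
    l: a deficit of more than x sqrt n. Hence the Chernoff bound with [- l]. *)
Lemma order_stat_upper_tail i (x : R) : 0 <= x ->
  (P [set w | (anchor R i + x * l < X i w)%R] <= (expR (2 - x))%:E)%E.
Proof.
move=> x0; have /andP[t0 t1] := anchor_itv i; have tE := anchorE i.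
have xl : 0 <= x * l by rewrite mulr_ge0 // ltW.
have [u1|u1] := leP (anchor R i + x * l) 1; last first.
  rewrite (_ : P _ = 0%E); first by rewrite lee_fin expR_ge0.
  apply/eqP; rewrite eq_le measure_ge0 andbT -(order_stat_gt1 i).
  apply: le_measure; rewrite ?inE; try exact: measurable_order_stat_gt.
  by move=> w /=; exact: lt_trans.
have u01 : 0 <= anchor R i + x * l <= 1 by rewrite u1 andbT addr_ge0.
rewrite prob_order_stat_gt // lee_fin.
have lN : (- l) ^+ 2 * n%:R = 1 by rewrite sqrrN.
apply: le_trans (binomial_tail x u01 lN).
apply: le_binomial_mean => // m mn.
case: leqP => // mi; rewrite mulr1n; case: (leP x) => // h; exfalso; move: h.
apply/negP; rewrite -leNgt.
have {}mi : (m%:R <= i%:R :> R) by rewrite ler_nat.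
rewrite (mulrDr n%:R) tE.
have -> : - l * (m%:R - (i%:R + 2^-1 + n%:R * (x * l))) =
  l * (i%:R - m%:R) + l / 2 + x * (l ^+ 2 * n%:R) by field.
have : 0 <= l * (i%:R - m%:R) by rewrite mulr_ge0 ?subr_ge0 // ltW.
by rewrite ln mulr1; move: l0; lra.
Qed.

(** Mirror image: a count of at least i + 1 against a mean of i + 1/2 - n x l. The midpoint anchor
    leaves a spare 1/2 on both sides. *)
Lemma order_stat_lower_tail i (x : R) : 0 <= x ->
  (P [set w | (X i w <= anchor R i - x * l)%R] <= (expR (2 - x))%:E)%E.
Proof.
move=> x0; have /andP[t0 t1] := anchor_itv i; have tE := anchorE i.
have xl : 0 <= x * l by rewrite mulr_ge0 // ltW.
have [u0|u0] := leP 0 (anchor R i - x * l); last first.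
  rewrite (_ : P _ = 0%E); first by rewrite lee_fin expR_ge0.
  apply/eqP; rewrite eq_le measure_ge0 andbT -(order_stat_le0 i).
  apply: le_measure; rewrite ?inE; try exact: measurable_order_stat_le.
  by move=> w /= h; exact: le_trans h (ltW u0).
have u01 : 0 <= anchor R i - x * l <= 1 by rewrite u0 /=; lra.
rewrite prob_order_stat_le // lee_fin.
apply: le_trans (binomial_tail x u01 ln).
apply: le_binomial_mean => // m mn.
case: leqP => // mi; rewrite mulr1n; case: (leP x) => // h; exfalso; move: h.
apply/negP; rewrite -leNgt.
have {}mi : (i%:R + 1 <= m%:R :> R) by rewrite natr1 ler_nat.
rewrite (mulrBr n%:R) tE.
have -> : l * (m%:R - (i%:R + 2^-1 - n%:R * (x * l))) =
  l * (m%:R - (i%:R + 1)) + l / 2 + x * (l ^+ 2 * n%:R) by field.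
have : 0 <= l * (m%:R - (i%:R + 1)) by rewrite mulr_ge0 ?subr_ge0 // ltW.
by rewrite ln mulr1; move: l0; lra.
Qed.

Lemma displacement_tail i (x : R) : 0 <= x ->
  (P [set w | (x * l < `|X i w - anchor R i|)%R] <= (2 * expR (2 - x))%:E)%E.
Proof.
move=> x0.
apply: (@le_trans _ _ (P ([set w | anchor R i + x * l < X i w] `|`
                          [set w | X i w <= anchor R i - x * l]))).
  apply: le_measure; rewrite ?inE.
  - rewrite -[X in measurable X]setTI.
    rewrite (_ : [set _ | _] = (fun w => `|X i w - anchor R i|) @^-1` `]x * l, +oo[%classic).
      by apply: measurable_displacement => //; exact: measurable_itv.
    by apply/seteqP; split => w /=; rewrite in_itv /= andbT.
  - by apply: measurableU; [exact: measurable_order_stat_gt | exact: measurable_order_stat_le].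
  - move=> w /=; rewrite lter_normr => /orP[h|h]; [left|right]; lra.
apply: (le_trans (measureU2 _ _ _)).
- exact: measurable_order_stat_gt.
- exact: measurable_order_stat_le.
rewrite mulr_natl mulr2n EFinD leeD //.
  exact: order_stat_upper_tail.
exact: order_stat_lower_tail.
Qed.

End tails.
End order_statistics.

(** * Power moments from exponential tails *)

(** One term of the exponential series at x / 2. The halved argument saves half of the decay of
    exp(-x) for summation. *)
Lemma exprn_le_expR (R : realType) (a : nat) (x : R) :
  0 <= x -> x ^+ a <= a`!%:R * 2 ^+ a * expR (x / 2).
Proof.
move=> x0; case: a => [|a].
  by rewrite expr0 fact0 !mul1r -expR0 ler_expR divr_ge0.
have := @expR_ge1Dxn R (x / 2) a (divr_ge0 x0 (ler0n R 2)).
have f0 : (0 : R) < a.+1`!%:R by rewrite ltr0n fact_gt0.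
have p0 : (0 : R) < 2 ^+ a.+1 by rewrite exprn_gt0.
rewrite expr_div_n => h.
have {}h : x ^+ a.+1 / 2 ^+ a.+1 / a.+1`!%:R <= expR (x / 2) by lra.
by move: h; rewrite !ler_pdivrMr // => h; rewrite mulrC mulrA (mulrC _ a.+1`!%:R) mulrC in h *;
  lra.
Qed.

Lemma power_expR_summable (R : realType) (a : nat) :
  exists2 K : R, 0 < K & forall M : nat,
    1 + \sum_(m < M) m.+2%:R ^+ a * (2 * expR (2 - m%:R)) <= K.
Proof.
pose q : R := expR (- 2^-1).
have q1 : 0 < 1 - q by rewrite subr_gt0 expR_lt1 oppr_lt0.
(* The exponents add up to (m + 2) / 2 + 2 - m = 3 - m / 2, whence [expR 3] and the ratio [q]. *)
pose C : R := a`!%:R * 2 ^+ a * (2 * expR 3).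
have C0 : 0 <= C by rewrite !mulr_ge0 ?exprn_ge0 ?expR_ge0.
exists (1 + C / (1 - q)); first by rewrite ltr_pwDl ?divr_ge0 ?(ltW q1).
move=> M; rewrite lerD2l.
apply: (@le_trans _ _ (\sum_(m < M) C * q ^+ m)).
  apply: ler_sum => m _.
  apply: (@le_trans _ _ (a`!%:R * 2 ^+ a * expR (m.+2%:R / 2) * (2 * expR (2 - m%:R)))).
    by rewrite ler_wpM2r ?mulr_ge0 ?expR_ge0 ?exprn_le_expR.
  rewrite /C /q -expRM_natr -!mulrA !ler_wpM2l ?exprn_ge0 //.
  rewrite mulrCA ler_wpM2l // -!expRD ler_expR -natr1 -natr1; lra.
rewrite -mulr_sumr ler_wpM2l // -(ler_pM2l q1) mulfV ?gt_eqF //.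
rewrite -opprB mulNr -subrX1 opprB lerBlDr lerDl exprn_ge0 ?expR_ge0 //.
Qed.

Lemma exprn_le_layers (R : realType) (a M : nat) (z : R) : 0 <= z <= M%:R ->
  z ^+ a <= 1 + \sum_(m < M) m.+2%:R ^+ a * (m%:R < z)%R%:R.
Proof.
move=> /andP[z0 zM].
have S0 : (0 : R) <= \sum_(m < M) m.+2%:R ^+ a * (m%:R < z)%R%:R.
  by apply: sumr_ge0 => m _; rewrite mulr_ge0 ?exprn_ge0.
have [z1|z1] := leP z 1.
  by apply: (@le_trans _ _ 1); [rewrite exprn_ile1 | rewrite lerDl].
have /andP[t1 t2] := truncn_itv z0.
(* With [k] one below the integer part, k < z < k + 2 holds even for an integer z, so layer [k]
   alone dominates. *)
case E : (Num.truncn z) t1 t2 => [|k] t1 t2; first by lra.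
have kz : k%:R < z by apply: lt_le_trans t1; rewrite ltr_nat.
have kM : (k < M)%N by rewrite -(ltr_nat R) (lt_le_trans kz).
rewrite (bigD1 (Ordinal kM)) //= kz mulr1 addrCA ler_wpDr //.
  by rewrite addr_ge0 // sumr_ge0 // => m _; rewrite mulr_ge0 ?exprn_ge0.
by rewrite lerXn2r ?nnegrE // ltW.
Qed.

Lemma sum_shift_le (R : numDomainType) (Q : nat -> R) (n h s : nat) :
  (forall i, 0 <= Q i) -> (s + h <= n)%N ->
  \sum_(j < h) Q (s + j)%N <= \sum_(i < n) Q i.
Proof.
move=> Q0 /subnKC <-; rewrite !big_split_ord /= -addrA.
rewrite ler_wpDl ?sumr_ge0 // lerDl sumr_ge0 //.
Qed.

(** * Moments of the displacements and their sum *)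

Section moments.
Context d (T : measurableType d) (R : realType) (P : probability T R) (n : nat)
  (U : 'I_n -> {RV P >-> R}).
Hypotheses (U_indep : mutually_independent U)
  (U_unif : forall j, uniform01 (U j)).
Variables (l : R).
Hypotheses (l0 : 0 < l) (ln : l ^+ 2 * n%:R = 1).

Let D (i : 'I_n) (w : T) : R := `|order_stat (fun j => U j) i w - anchor R i|.

Let measurable_D i : measurable_fun setT (D i).
Proof. exact: measurable_displacement. Qed.

Let measurable_DX a i : measurable_fun setT (fun w => (D i w ^+ a)%:E).
Proof. by apply/measurable_EFinP; exact: measurable_funX. Qed.

Let measurable_D_gt i (s : R) : measurable [set w | s < D i w].
Proof.
rewrite -[X in measurable X]setTI (_ : [set _ | _] = D i @^-1` `]s, +oo[%classic).
  by apply: measurable_D => //; exact: measurable_itv.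
by apply/seteqP; split => w /=; rewrite in_itv /= andbT.
Qed.

Let measurable_D_ge i (s : R) : measurable [set w | s <= D i w].
Proof.
rewrite -[X in measurable X]setTI (_ : [set _ | _] = D i @^-1` `[s, +oo[%classic).
  by apply: measurable_D => //; exact: measurable_itv.
by apply/seteqP; split => w /=; rewrite in_itv /= andbT.
Qed.

(** Layer decomposition of D / l, each layer being bounded by [displacement_tail]. As [K] serves
    every [M], the number of layers may grow with [n]. *)
Lemma displacement_moment_le a (K : R) i :
  (forall M : nat, 1 + \sum_(m < M) m.+2%:R ^+ a * (2 * expR (2 - m%:R)) <= K) ->
  ('E_P[fun w => (D i w ^+ a)%R] <= (l ^+ a * K)%:E)%E.
Proof.
move=> hK; rewrite unlock.
(* Enough layers to reach D / l <= 1 / l, valid off the null set [N] below. *)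
pose M := (Num.truncn l^-1).+1.
have Ml : 1 <= M%:R * l.
  by rewrite -ler_pdivrMr // mul1r ltW // truncnS_gt.
pose N := [set w | order_stat (fun j => U j) i w <= 0] `|`
          [set w | 1 < order_stat (fun j => U j) i w].
have mN : measurable N.
  by apply: measurableU; [exact: measurable_order_stat_le | exact: measurable_order_stat_gt].
have N0 : P N = 0%E.
  apply/eqP; rewrite eq_le measure_ge0 andbT.
  apply: (le_trans (measureU2 _ _ _)).
  - exact: measurable_order_stat_le.
  - exact: measurable_order_stat_gt.
  by rewrite [X in (X + _)%E]order_stat_le0 // [X in (_ + X)%E]order_stat_gt1 // adde0.
rewrite (ge0_negligible_integral mN) //; last first.
  by move=> w _; rewrite lee_fin exprn_ge0 // normr_ge0.
have la0 : 0 <= l ^+ a by rewrite exprn_ge0 // ltW.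
(* Index 0 is the constant 1 of [exprn_le_layers], index [m.+1] its layer [m], all scaled by
   [l ^+ a]. *)
pose g (k : nat) (w : T) : \bar R :=
  (if k is m.+1
   then (l ^+ a * m.+2%:R ^+ a)%:E * (\1_[set w | (m%:R * l < D i w)%R] w)%:E
   else (l ^+ a)%:E)%E.
have g0 k w : (0 <= g k w)%E.
  by case: k => [|m] /=; rewrite ?mule_ge0 // lee_fin // mulr_ge0 // exprn_ge0.
have mg k : measurable_fun setT (g k).
  case: k => [|m]; first exact: measurable_cst.
  apply: measurable_funeM; apply/measurable_EFinP; apply: measurable_indic.
  exact: measurable_D_gt.
have mTN : measurable ([set: T] `\` N) by apply: measurableD.
apply: (@le_trans _ _ (\int[P]_(w in [set: T] `\` N) (\sum_(k < M.+1) g k w))%E).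
  apply: ge0_le_integral => //.
  - by move=> w _; rewrite lee_fin exprn_ge0 // normr_ge0.
  - by apply: measurable_funTS; exact: measurable_DX.
  - by apply: measurable_funTS; exact: emeasurable_sum.
  move=> w [_ /not_orP[/negP X0 /negP X1]].
  have D1 : D i w <= 1.
    have /andP[t0 t1] := anchor_itv R i.
    move: X0 X1; rewrite -ltNge -leNgt /D ler_norml; lra.
  have zM : 0 <= D i w / l <= M%:R.
    by rewrite divr_ge0 ?normr_ge0 ?(ltW l0) //= ler_pdivrMr // (le_trans D1).
  have := exprn_le_layers a zM.
  rewrite expr_div_n ler_pdivrMr ?exprn_gt0 // => h.
  rewrite big_ord_recl /=.
  rewrite (eq_bigr (fun m : 'I_M =>
    (l ^+ a * (m.+2%:R ^+ a * (m%:R < D i w / l)%R%:R))%:E)).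
    by rewrite sumEFin -EFinD lee_fin (le_trans h) // mulrC mulrDr mulr1 mulr_sumr.
  move=> m _; rewrite /bump add0n -EFinM -mulrA; congr (_ * (_ * _))%:E.
  rewrite indicE; congr (nat_of_bool _)%:R.
  by rewrite ltr_pdivlMr //; apply/idP/idP; rewrite inE.
apply: (@le_trans _ _ (\int[P]_w (\sum_(k < M.+1) g k w))%E).
  apply: ge0_subset_integral => //; first exact: emeasurable_sum.
  by move=> w _; exact: sume_ge0.
rewrite ge0_integral_sum // big_ord_recl /= integral_cst //.
rewrite [X in (_ * X)%E]probability_setT mule1.
have hm (m : 'I_M) : (\int[P]_w g (bump 0 m) w <=
    (l ^+ a * (m.+2%:R ^+ a * (2 * expR (2 - m%:R))))%:E)%E.
  rewrite /bump /= add0n ge0_integralZl //; last first.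
  - by rewrite lee_fin mulr_ge0 // exprn_ge0.
  - by apply/measurable_EFinP; apply: measurable_indic; exact: measurable_D_gt.
  rewrite integral_indic //.
  rewrite setIT mulrA [in leRHS]EFinM; apply: lee_pmul => //.
    by rewrite lee_fin mulr_ge0 // exprn_ge0.
  exact: displacement_tail.
apply: (@le_trans _ _ ((l ^+ a)%:E + \sum_(m < M)
    (l ^+ a * (m.+2%:R ^+ a * (2 * expR (2 - m%:R))))%:E)%E).
  by rewrite leeD2l //; apply: lee_sum => m _; exact: hm.
rewrite sumEFin -EFinD lee_fin -mulr_sumr -[X in X + _]mulr1 -mulrDr.
by rewrite ler_wpM2l.
Qed.

(** Markov's inequality for the [a]-th power. *)
Lemma displacement_moment_ge a (s : R) i : 0 <= s ->
  ((s ^+ a)%:E * P [set w | (s <= D i w)%R] <= 'E_P[fun w => (D i w ^+ a)%R])%E.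
Proof.
move=> s0; rewrite unlock -[X in P X]setIT -integral_indic //.
rewrite -ge0_integralZl //; last 2 first.
- by apply/measurable_EFinP; exact: measurable_indic.
- by rewrite lee_fin exprn_ge0.
apply: ge0_le_integral => //.
- by move=> w _; rewrite mule_ge0 // lee_fin exprn_ge0.
- apply: measurable_funeM; apply/measurable_EFinP; exact: measurable_indic.
move=> w _; rewrite -EFinM lee_fin indicE.
have [/set_mem /= sD|_] := boolP (w \in _).
  by rewrite mulr1 lerXn2r ?nnegrE // (le_trans s0).
by rewrite mulr0 exprn_ge0 // normr_ge0.
Qed.

(** With indices from 0, a count N >= k + r puts X_i1 at or below k/n, against the anchor (k + r -
    1/2)/n; a count N <= k - r puts X_i2 above k/n, against (k - r + 1/2)/n. *)
Lemma displacement_anticoncentration (k r : nat) (i1 i2 : 'I_n) :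
  i1.+1 = (k + r)%N -> (i2 + r)%N = k ->
  1 / 16 <= k%:R / n%:R * (1 - k%:R / n%:R) :> R -> r%:R * l <= 8^-1 ->
  (((32 * (48 * (64 * expR 2)))^-1 : R)%:E <=
   P [set w | ((r%:R - 2^-1) / n%:R <= D i1 w)%R] +
   P [set w | ((r%:R - 2^-1) / n%:R <= D i2 w)%R])%E.
Proof.
move=> i1E i2E p16 rl.
have n0 : (0 : R) < n%:R by rewrite ltr0n (leq_ltn_trans _ (ltn_ord i1)).
set p := k%:R / n%:R in p16 *.
have np : n%:R * p = k%:R by rewrite /p mulrCA mulfV ?mulr1 // gt_eqF.
have p01 : 0 <= p <= 1.
  rewrite divr_ge0 //= ler_pdivrMr // mul1r ler_nat.
  by have := ltn_ord i1; lia.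
pose A (m : nat) := (8^-1 <= `|l * (m%:R - n%:R * p)|)%R.
apply: (@le_trans _ _ (P [set w | A (count_le (fun j => U j) p w)])).
  rewrite (count_le_binomial U_indep U_unif) // lee_fin.
  exact: binomial_anticoncentration.
apply: (@le_trans _ _ (P ([set w | (r%:R - 2^-1) / n%:R <= D i1 w] `|`
                          [set w | (r%:R - 2^-1) / n%:R <= D i2 w]))); last first.
  exact: measureU2.
apply: le_measure; rewrite ?inE.
- exact: measurable_count_le.
- exact: measurableU.
move=> w /=; rewrite /A np normrM gtr0_norm // => h.
set N := count_le _ p w in h.
have {h} : r%:R <= `|N%:R - k%:R| :> R.
  by rewrite -(ler_pM2l l0) mulrC (le_trans rl).
have t1 := anchorE R i1; have t2 := anchorE R i2.
have i1R : i1%:R + 1 = k%:R + r%:R :> R by rewrite natr1 i1E natrD.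
have i2R : i2%:R + r%:R = k%:R :> R by rewrite -natrD i2E.
rewrite lter_normr => /orP[h|h]; [left|right].
  have : order_stat (fun j => U j) i1 w <= p.
    by rewrite order_stat_le -/N i1E -(ler_nat R) natrD; lra.
  move=> Xp; rewrite /D distrC (le_trans _ (ler_norm _)) //.
  rewrite ler_pdivrMr // mulrBl (mulrC (anchor _ _)) t1.
  have := ler_wpM2l (ltW n0) Xp; rewrite np (mulrC _ n%:R); lra.
have : p < order_stat (fun j => U j) i2 w.
  by rewrite order_stat_gt -/N -(ler_nat R); lra.
move=> /ltW Xp; rewrite /D (le_trans _ (ler_norm _)) //.
rewrite ler_pdivrMr // mulrBl (mulrC (anchor _ _)) t2.
have := ler_wpM2l (ltW n0) Xp; rewrite np (mulrC _ n%:R); lra.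
Qed.

Lemma expected_displacement_le a (K : R) :
  (forall M : nat, 1 + \sum_(m < M) m.+2%:R ^+ a * (2 * expR (2 - m%:R)) <= K) ->
  (expected_displacement U a <= (n%:R * (l ^+ a * K))%:E)%E.
Proof.
move=> hK; apply: (@le_trans _ _ (\sum_(i < n) (l ^+ a * K)%:E)%E).
  by apply: lee_sum => i _; exact: displacement_moment_le.
by rewrite sumEFin sumr_const card_ord mulr_natl.
Qed.

Lemma expected_displacement_ge a (h r : nat) :
  (0 < r <= h)%N -> (4 * h <= n <= 8 * h)%N -> r%:R * l <= 8^-1 ->
  ((((r%:R - 2^-1) / n%:R) ^+ a *
    (h%:R * (64 * (48 * (64 * expR 2)))^-1))%:E <= expected_displacement U a)%E.
Proof.
move=> /andP[r0 rh] /andP[hn nh] rl.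
have n0 : (0 : R) < n%:R by rewrite ltr0n; lia.
set s := (r%:R - 2^-1) / n%:R.
have s0 : 0 <= s.
  by rewrite divr_ge0 // ?(ltW n0) //; have : (1 : R) <= r%:R by [rewrite ler1n]; lra.
pose q (i : 'I_n) : R := fine (P [set w | s <= D i w]).
have qE i : P [set w | s <= D i w] = (q i)%:E by rewrite fineK ?fin_num_measure.
have q0 i : 0 <= q i by rewrite fine_ge0 // measure_ge0.
apply: (@le_trans _ _ (\sum_(i < n) (s ^+ a * q i)%:E)%E); last first.
  by apply: lee_sum => i _; rewrite EFinM -qE; exact: displacement_moment_ge.
rewrite sumEFin lee_fin -mulr_sumr ler_wpM2l ?exprn_ge0 //.
(* Extension by 0, so that windows of indices can be shifted in [nat]. *)
pose Q (i : nat) : R := oapp q 0 (insub i).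
have Q0 i : 0 <= Q i by rewrite /Q; case: insubP => //= *.
have -> : \sum_(i < n) q i = \sum_(i < n) Q i.
  by apply: eq_bigr => i _; rewrite /Q valK.
(* For k = h + j with j < h, the two sensors sweep two windows of length [h], each summing to at
   most the total. *)
have lo := @sum_shift_le R Q n h (h - r) Q0 ltac:(lia).
have hi := @sum_shift_le R Q n h (h + r).-1 Q0 ltac:(lia).
have : \sum_(j < h) (32 * (48 * (64 * expR 2)))^-1 <=
    \sum_(j < h) (Q ((h + r).-1 + j)%N + Q (h - r + j)%N).
  apply: ler_sum => j _; have jh := ltn_ord j.
  have h1 : ((h + r).-1 + j < n)%N by lia.
  have h2 : (h - r + j < n)%N by lia.
  have := @displacement_anticoncentration (h + j) r (Ordinal h1) (Ordinal h2).
  rewrite !qE -EFinD lee_fin /Q !insubT /=; apply => //=.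
  - by lia.
  - by lia.
  (* On [1/8, 1/2] the product p (1 - p) is at least 7/64, hence above 1/16. *)
  have k1 : 8^-1 <= (h + j)%:R / n%:R :> R.
    by rewrite ler_pdivlMr // mulrC ler_pdivrMr // -natrM ler_nat; lia.
  have k2 : (h + j)%:R / n%:R <= 2^-1 :> R.
    by rewrite ler_pdivrMr // mulrC ler_pdivlMr // -natrM ler_nat; lia.
  nra.
rewrite big_split /= sumr_const card_ord -mulr_natl.
(* The two windows cost a factor 2. *)
have -> : (64 * (48 * (64 * expR 2)))^-1 = (32 * (48 * (64 * expR 2)))^-1 / 2 :> R.
  by field; rewrite gt_eqF // expR_gt0.
lra.
Qed.
End moments.

(** * The rate and the final constants *)

(** Exhibits the rate as [n] summands of size n^(-a/2), the form of both bounds on the sum. *)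
Lemma inv_powR_half_sub1 (R : realType) (a n : nat) : (0 < a)%N -> (0 < n)%N ->
  1 / n%:R `^ (a%:R / 2 - 1) = n%:R * (Num.sqrt n%:R)^-1 ^+ a :> R.
Proof.
move=> a0 n0.
have nR : (0 : R) < n%:R by rewrite ltr0n.
have a2 : (0 : R) < a%:R / 2 by rewrite divr_gt0 // ltr0n.
have := mulr_powRB1 (ltW nR) a2.
rewrite (mulrC a%:R) powRrM powR12_sqrt ?ler0n // powR_mulrn ?sqrtr_ge0 // => h.
have s0 : Num.sqrt n%:R ^+ a != 0 :> R by rewrite expf_neq0 // gt_eqF // sqrtr_gt0.
have p0 : (n%:R : R) `^ (2^-1 * a%:R - 1) != 0 by rewrite gt_eqF // powR_gt0.
by rewrite exprVn -h; field; rewrite p0 gt_eqF.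
Qed.

Theorem theorem3 (R : realType) (a : nat) (a_odd : odd a)
  (d : nat -> measure_display) (T : forall n, measurableType (d n))
  (P : forall n, probability (T n) R)
  (U : forall n, 'I_n -> {RV (P n) >-> R})
  (U_indep : forall n, mutually_independent (U n))
  (U_unif : forall n (i : 'I_n), uniform01 (U n i)) :
  ((fun n : nat => fine (expected_displacement (U n) a)) : nat -> R^o) \is
    is_bigTheta \oo
      ((fun n : nat => 1 / n%:R `^ (a%:R / 2 - 1)) : nat -> R^o).
Proof.
have [K K0 hK] := power_expR_summable R a.
rewrite qualifE; apply/asboolP.
pose c : R := (64 * (48 * (64 * expR 2)))^-1.
have c0 : 0 < c by rewrite invr_gt0 !mulr_gt0 // expR_gt0.
(* 1/32 comes from (r - 1/2) / n >= l / 32, 1/8 from h >= n / 8, and [c] from anticoncentration. *)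
exists (32^-1 ^+ a * (8^-1 * c), K) => /=.
  by rewrite K0 !mulr_gt0 // exprn_gt0.
near=> n.
(* Ensures sqrt n >= 8, so that [r] below is at least 1. *)
have n64 : (64 <= n)%N by near: n; exact: nbhs_infty_ge.
have n64R : (64 : R) <= n%:R by rewrite ler_nat.
have nR : (0 : R) < n%:R by lra.
pose L : R := Num.sqrt n%:R.
have L2 : L ^+ 2 = n%:R by rewrite sqr_sqrtr // ltW.
have L8 : 8 <= L.
  rewrite -(@ler_pXn2r _ 2) ?nnegrE ?sqrtr_ge0 // L2; apply: le_trans n64R; lra.
have L0 : 0 < L by lra.
pose l : R := L^-1.
have l0 : 0 < l by rewrite invr_gt0.
have ln : l ^+ 2 * n%:R = 1 by rewrite -L2 exprVn mulVf // expf_neq0 // gt_eqF.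
rewrite inv_powR_half_sub1 //; [|by case: (a) a_odd|by lia].
rewrite -/L -/l.
have g0 : 0 <= n%:R * l ^+ a by rewrite mulr_ge0 ?exprn_ge0 // ltW.
pose r := Num.truncn (L / 8).
have L80 : 0 <= L / 8 by lra.
have /andP[rL Lr] := truncn_itv L80.
rewrite -/r in rL Lr; rewrite -(natr1 r) in Lr.
have r1 : (0 < r)%N by rewrite -(ltr0n R); lra.
pose h := (n %/ 4)%N.
have hn : (4 * h <= n <= 8 * h)%N by rewrite /h; lia.
have hR : n%:R / 8 <= h%:R :> R.
  by rewrite ler_pdivrMr // -natrM ler_nat; lia.
have rh : (0 < r <= h)%N.
  rewrite r1 -(ler_nat R) (le_trans rL) // (le_trans _ hR) //; nra.
have rl : r%:R * l <= 8^-1.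
  by rewrite /l ler_pdivrMr //; lra.
have lo := expected_displacement_ge (U_indep n) (U_unif n) l0 ln a rh hn rl.
have up := expected_displacement_le (U_indep n) (U_unif n) l0 ln hK.
rewrite -/c in lo.
(* From r >= 1, r - 1/2 >= (r + 1) / 4, and r + 1 > L / 8. *)
have sl : 32^-1 * l <= (r%:R - 2^-1) / n%:R.
  have r1R : (1 : R) <= r%:R by rewrite ler1n.
  rewrite ler_pdivlMr // -mulrA (_ : l * n%:R = L); first by lra.
  by rewrite -L2 expr2 mulKf // gt_eqF.
have lo' : 32^-1 ^+ a * (8^-1 * c) * (n%:R * l ^+ a) <=
    ((r%:R - 2^-1) / n%:R) ^+ a * (h%:R * c).
  rewrite (_ : _ * _ = (32^-1 * l) ^+ a * (n%:R / 8 * c)); last first.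
    by rewrite exprMn; ring.
  apply: ler_pM; rewrite ?exprn_ge0 ?mulr_ge0 ?(ltW l0) ?(ltW c0) ?ler_pM2r //.
  by rewrite lerXn2r ?nnegrE // ?(le_trans _ sl) // mulr_ge0 // ltW.
have E0 : (0 <= expected_displacement (U n) a)%E.
  apply: le_trans lo; rewrite lee_fin; apply: le_trans lo'.
  by rewrite !mulr_ge0 ?exprn_ge0 // ltW.
(* [fine] sends infinite values to 0, so finiteness is needed to carry the bounds over. *)
have Efin : expected_displacement (U n) a \is a fin_num.
  by rewrite ge0_fin_numE // (le_lt_trans up) // ltry.
rewrite -(fineK Efin) !lee_fin in lo up E0.
rewrite !ger0_norm //; split; last by rewrite mulrC -mulrA.
exact: le_trans lo' lo.
Unshelve. all: by end_near.
Qed.
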